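(* Let $G$ be a group with identity element $e$, let $S$ be a ring graded by $G$, and put $R = S_e$. The following assertions are equivalent: (i) $S$ is epsilon-strongly graded by $G$; (ii) $S$ is symmetrically graded by $G$, and for every $g\in G$ the ideal $S_gS_{g^{-1}}$ of $R$ is unital; (iii) for every $g\in G$ there is an element $\epsilon_g \in S_gS_{g^{-1}}$ such that for all $s\in S_g$ the relations $\epsilon_g s = s = s\epsilon_{g^{-1}}$ hold; (iv) for every $g\in G$ the left $R$-module $S_g$ is finitely generated and projective, and the map $n_g : S_g \to \mathrm{Hom}_R({}_RS_{g^{-1}}, R)$, defined by $n_g(s)(t) = ts$ for $s\in S_g$ and $t\in S_{g^{-1}}$, is an isomorphism of right $R$-modules.
   Context: Rings are associative with a nonzero multiplicative identity $1$. For additive subgroups $X,Y$ of $S$, $XY$ denotes the set of finite sums of products $xy$ with $x\in X$, $y\in Y$. $S$ is graded by $G$ if there are additive subgroups $S_g\subseteq S$ ($g\in G$) with $S=\bigoplus_{g\in G}S_g$ and $S_gS_h\subseteq S_{gh}$ for all $g,h\in G$. An ideal of $R$ is called unital if it has its own multiplicative identity element (allowed to be $0$). $S$ is epsilon-strongly graded by $G$ if for each $g\in G$, $S_gS_{g^{-1}}$ is a unital ideal of $R$, and for all $g,h\in G$ the equalities $S_gS_h = S_gS_{g^{-1}}S_{gh} = S_{gh}S_{h^{-1}}S_h$ hold. $S$ is symmetrically graded by $G$ if $S_gS_{g^{-1}}S_g = S_g$ for every $g\in G$. $\mathrm{Hom}_R({}_RS_{g^{-1}},R)$ is the set of left $R$-module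 homomorphisms $S_{g^{-1}}\to R$, with right $R$-module structure $(f\cdot r)(t) = f(t)r$. *)

(* Defs.v *)
From HB Require Import structures.
From mathcomp Require Import all_boot all_order all_algebra.
From mathcomp Require Import finmap.
From mathcomp Require Import boolp classical_sets.

Set Implicit Arguments.
Unset Strict Implicit.
Unset Printing Implicit Defensive.

Import GRing.Theory.
Local Open Scope ring_scope.

(* Modules over a ring that need not be commutative. As usual in the library,
   a left R-module is an lmodType R and a right R-module is an
   lmodType R^c: there [r *: m] is the right action m . r. *)
Section Modules.
Variable R : nzRingType.

Definition finitely_generated (M : lmodType R) : Prop :=
  exists (n : nat) (v : 'I_n -> M),
    forall m : M, exists c : 'I_n -> R, m = \sum_(i < n) c i *: v i.

Definition projective (M : lmodType R) : Prop :=
  forall (A B : lmodType R) (p : {linear A -> B}) (f : {linear M -> B}),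
    (forall b : B, exists a : A, p a = b) ->
    exists h : {linear M -> A}, forall m : M, p (h m) = f m.

Definition module_iso (M N : lmodType R) (f : M -> N) : Prop :=
  linear f /\ bijective f.

(* Hom_R(M, R) for a left R-module M. *)
Definition left_dual (M : lmodType R) : Type := {linear M -> R^o}.

Section LeftDual.
Variable M : lmodType R.
Implicit Types (f h : left_dual M) (r : R).

Definition dual_eval f : M -> R := (f : {linear M -> R^o}).

Lemma dual_evalP f h : dual_eval f =1 dual_eval h -> f = h.
Proof.
case: f h => [f [[fA] [fB]]] [h [[hA] [hB]]] /= /funext; rewrite /dual_eval /=.
move=> fh; case: _ / fh hA hB => hA hB.
by rewrite (Prop_irrelevance fA hA) (Prop_irrelevance fB hB).
Qed.

Lemma dual_linearP f : linear (dual_eval f : M -> R^o).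
Proof. exact: (@linearP _ _ _ _ (f : {linear M -> R^o})). Qed.

Definition mk_dual (phi : M -> R) (phiL : linear (phi : M -> R^o)) :
    left_dual M :=
  HB.pack_for {linear M -> R^o} (phi : M -> R^o)
    (GRing.isLinear.Build R M R^o *:%R (phi : M -> R^o) phiL).

Lemma dual0_subproof : linear ((fun=> 0) : M -> R^o).
Proof. by move=> a u v; rewrite scaler0 addr0. Qed.

Lemma dualN_subproof f : linear ((fun m => - dual_eval f m) : M -> R^o).
Proof. by move=> a u v /=; rewrite dual_linearP opprD scalerN. Qed.

Lemma dualD_subproof f h :
  linear ((fun m => dual_eval f m + dual_eval h m) : M -> R^o).
Proof. by move=> a u v /=; rewrite !dual_linearP scalerDr addrACA. Qed.

Lemma dualZ_subproof (r : R) f :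
  linear ((fun m => dual_eval f m * r) : M -> R^o).
Proof. by move=> a u v /=; rewrite dual_linearP mulrDl /GRing.scale /= mulrA. Qed.

Definition dual0 := mk_dual dual0_subproof.
Definition dualN f := mk_dual (dualN_subproof f).
Definition dualD f h := mk_dual (dualD_subproof f h).
Definition dualZ (r : R^c) f := mk_dual (dualZ_subproof r f).

HB.instance Definition _ := gen_eqMixin (left_dual M).
HB.instance Definition _ := gen_choiceMixin (left_dual M).

Lemma dualDA : associative dualD.
Proof. by move=> x y z; apply: dual_evalP => m; apply: addrA. Qed.
Lemma dualDC : commutative dualD.
Proof. by move=> x y; apply: dual_evalP => m; apply: addrC. Qed.
Lemma dualD0 : left_id dual0 dualD.
Proof. by move=> x; apply: dual_evalP => m; apply: add0r. Qed.
Lemma dualDN : left_inverse dual0 dualN dualD.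
Proof. by move=> x; apply: dual_evalP => m; apply: addNr. Qed.

HB.instance Definition _ :=
  GRing.isZmodule.Build (left_dual M) dualDA dualDC dualD0 dualDN.

Lemma dualZA (a b : R^c) f : dualZ a (dualZ b f) = dualZ (a * b) f.
Proof. by apply: dual_evalP => m; rewrite /dual_eval /= -mulrA. Qed.
Lemma dual1Z : left_id 1 dualZ.
Proof. by move=> x; apply: dual_evalP => m; apply: mulr1. Qed.
Lemma dualZDr : right_distributive dualZ +%R.
Proof. by move=> a x y; apply: dual_evalP => m; apply: mulrDl. Qed.
Lemma dualZDl f : {morph dualZ^~ f : a b / a + b}.
Proof. by move=> a b; apply: dual_evalP => m; apply: mulrDr. Qed.

HB.instance Definition _ := GRing.Zmodule_isLmodule.Build
  R^c (left_dual M) dualZA dual1Z dualZDr dualZDl.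

End LeftDual.
End Modules.

(* A G-grading of S. The direct sum condition says that every element of S is,
   in exactly one way, a sum of a finitely supported family of homogeneous
   elements. *)
Record grading (G : groupType) (S : nzRingType) := Grading {
  component :> G -> zmodClosed S;
  component_directP : forall s : S,
    exists! c : {fsfun G -> S with 0},
      (forall g, c g \in component g) /\ s = \sum_(g <- finsupp c) c g;
  component_mul : forall (g h : G) (x y : S),
    x \in component g -> y \in component h -> x * y \in component (g * h)%g
}.

Section Graded.
Variables (G : groupType) (S : nzRingType) (gr : grading G S).

Lemma component1 : 1 \in gr 1%g.
Proof.
have [c [[cP c1] _]] := component_directP gr 1.
suff ce s : c 1%g * s = s by rewrite -[1]ce mulr1.
have homogE h x : x \in gr h -> c 1%g * x = x.
  move=> xh.
  have [d [_ dU]] := component_directP gr x.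
  pose d1 : {fsfun G -> S with 0} := [fsfun g in [fset h]%fset => x].
  pose A := [fset (g * h)%g | g in finsupp c]%fset.
  pose d2 : {fsfun G -> S with 0} := [fsfun g in A => c (g / h)%g * x].
  have d2E g : d2 g = c (g / h)%g * x.
    rewrite fsfunE; case: ifPn => // gA.
    case: finsuppP => [_|]; first by rewrite mul0r.
    move=> gc; case/negP: gA; apply/imfsetP; exists (g / h)%g => //=.
    by rewrite mulgVK.
  have e1 : d = d1.
    apply: dU; split=> [g|].
      rewrite fsfunE inE; case: eqP => [->//|_]; exact: rpred0.
    have sub : (finsupp d1 `<=` [fset h])%fset by exact: finsupp_sub.
    rewrite (big_fset_incl _ sub) => [|g _ /fsfun_dflt //].
    by rewrite big_seq_fset1 fsfunE inE eqxx.
  have e2 : d = d2.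
    apply: dU; split=> [g|].
      by rewrite d2E -{2}(mulgVK h g); apply: component_mul.
    have sub : (finsupp d2 `<=` A)%fset by exact: finsupp_sub.
    rewrite (big_fset_incl _ sub) => [|g _ /fsfun_dflt //].
    rewrite big_imfset => [|a b _ _ /= /mulIg //].
    rewrite -[LHS]mul1r c1 mulr_suml; apply: eq_bigr => g _.
    by rewrite d2E mulgK.
  have := d2E h; rewrite -e2 e1 fsfunE inE eqxx mulgV.
  by move=> <-.
have [d [[dP ->] _]] := component_directP gr s.
by rewrite mulr_sumr; apply: eq_bigr => g _; apply: homogE (dP g).
Qed.

(* S_g as an additive group; its two module structures are put on it and on
   the copy [right_piece g] below. *)
Definition piece (g : G) : Type := {s : S | s \in gr g}.

HB.instance Definition _ g := SubChoice.on (piece g).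
HB.instance Definition _ g := [SubChoice_isSubZmodule of piece g by <:].

(* R = S_e as a ring. *)
Definition base_ring : Type := piece 1%g.
HB.instance Definition _ := GRing.SubZmodule.on base_ring.

Lemma base_mul_subproof (x y : S) :
  x \in gr 1%g -> y \in gr 1%g -> x * y \in gr 1%g.
Proof. by move=> xe ye; have := component_mul xe ye; rewrite mulg1. Qed.

Definition base_one : base_ring := Sub (1 : S) component1.
Definition base_mul (r t : base_ring) : base_ring :=
  Sub (val r * val t) (base_mul_subproof (valP r) (valP t)).

Lemma base_mulA : associative base_mul.
Proof. by move=> x y z; apply: val_inj; rewrite /= mulrA. Qed.
Lemma base_mul1 : left_id base_one base_mul.
Proof. by move=> x; apply: val_inj; rewrite /= mul1r. Qed.
Lemma base_1mul : right_id base_one base_mul.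
Proof. by move=> x; apply: val_inj; rewrite /= mulr1. Qed.
Lemma base_mulDl : left_distributive base_mul +%R.
Proof. by move=> x y z; apply: val_inj; rewrite /= mulrDl. Qed.
Lemma base_mulDr : right_distributive base_mul +%R.
Proof. by move=> x y z; apply: val_inj; rewrite /= mulrDr. Qed.
Lemma base_one_neq0 : base_one != 0.
Proof. by rewrite -val_eqE /= oner_eq0. Qed.

HB.instance Definition _ := GRing.Zmodule_isNzRing.Build base_ring
  base_mulA base_mul1 base_1mul base_mulDl base_mulDr base_one_neq0.

Section Piece.
Variable g : G.

Lemma piece_scale_subproof (r x : S) :
  r \in gr 1%g -> x \in gr g -> r * x \in gr g.
Proof. by move=> re xg; have := component_mul re xg; rewrite mul1g. Qed.

Definition piece_scale (r : base_ring) (x : piece g) : piece g :=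
  Sub (val r * val x) (piece_scale_subproof (valP r) (valP x)).

Lemma piece_scaleA a b x :
  piece_scale a (piece_scale b x) = piece_scale (a * b) x.
Proof. by apply: val_inj; rewrite /= mulrA. Qed.
Lemma piece_scale1 : left_id 1 piece_scale.
Proof. by move=> x; apply: val_inj; rewrite /= mul1r. Qed.
Lemma piece_scaleDr : right_distributive piece_scale +%R.
Proof. by move=> a x y; apply: val_inj; rewrite /= mulrDr. Qed.
Lemma piece_scaleDl x : {morph piece_scale^~ x : a b / a + b}.
Proof. by move=> a b; apply: val_inj; rewrite /= mulrDl. Qed.

HB.instance Definition _ := GRing.Zmodule_isLmodule.Build
  base_ring (piece g) piece_scaleA piece_scale1 piece_scaleDr piece_scaleDl.

Definition right_piece : Type := piece g.
HB.instance Definition _ := GRing.SubZmodule.on right_piece.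

Lemma right_piece_scale_subproof (r x : S) :
  r \in gr 1%g -> x \in gr g -> x * r \in gr g.
Proof. by move=> re xg; have := component_mul xg re; rewrite mulg1. Qed.

Definition right_piece_scale (r : base_ring^c) (x : right_piece) :
    right_piece :=
  Sub (val x * val (r : base_ring))
      (right_piece_scale_subproof (valP (r : base_ring)) (valP x)).

Lemma right_piece_scaleA a b x :
  right_piece_scale a (right_piece_scale b x) = right_piece_scale (a * b) x.
Proof. by apply: val_inj; rewrite /= mulrA. Qed.
Lemma right_piece_scale1 : left_id 1 right_piece_scale.
Proof. by move=> x; apply: val_inj; rewrite /= mulr1. Qed.
Lemma right_piece_scaleDr : right_distributive right_piece_scale +%R.
Proof. by move=> a x y; apply: val_inj; rewrite /= mulrDl. Qed.
Lemma right_piece_scaleDl x : {morph right_piece_scale^~ x : a b / a + b}.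
Proof. by move=> a b; apply: val_inj; rewrite /= mulrDr. Qed.

HB.instance Definition _ := GRing.Zmodule_isLmodule.Build base_ring^c
  right_piece right_piece_scaleA right_piece_scale1
  right_piece_scaleDr right_piece_scaleDl.

End Piece.

Section Dual.
Variable g : G.

Lemma pairing_subproof (t x : S) :
  t \in gr g^-1%g -> x \in gr g -> t * x \in gr 1%g.
Proof. by move=> tg xg; have := component_mul tg xg; rewrite mulVg. Qed.

Definition pairing (s : right_piece g) (t : piece g^-1%g) : base_ring :=
  Sub (val t * val s) (pairing_subproof (valP t) (valP s)).

Lemma pairing_linear s : linear (pairing s : piece g^-1%g -> base_ring^o).
Proof. by move=> a u v; apply: val_inj; rewrite /= mulrDl mulrA. Qed.

(* n_g : S_g -> Hom_R(S_{g^-1}, R), n_g(s)(t) = t s. *)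
Definition to_dual (s : right_piece g) : left_dual (piece g^-1%g) :=
  mk_dual (pairing_linear s).

End Dual.

Local Open Scope classical_set_scope.

(* The carrier of S_g, as a subset of S. *)
Definition component_set (g : G) : set S := [set x | x \in gr g].

(* XY, the finite sums of products x y. *)
Definition mulset (X Y : set S) : set S :=
  [set z | exists (n : nat) (x y : 'I_n -> S),
     [/\ forall i, X (x i), forall i, Y (y i) & z = \sum_(i < n) x i * y i]].

Definition base_ideal (I : set S) : Prop :=
  [/\ I `<=` component_set 1%g,
      I 0,
      forall x y, I x -> I y -> I (x - y) &
      forall r x, component_set 1%g r -> I x -> I (r * x) /\ I (x * r)].

Definition unital_ideal (I : set S) : Prop :=
  base_ideal I /\ exists2 u, I u & forall x, I x -> u * x = x /\ x * u = x.

Definition epsilon_strongly_graded : Prop :=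
  (forall g, unital_ideal (mulset (component_set g) (component_set g^-1%g))) /\
  forall g h,
    mulset (component_set g) (component_set h) =
      mulset (mulset (component_set g) (component_set g^-1%g))
             (component_set (g * h)%g) /\
    mulset (mulset (component_set g) (component_set g^-1%g))
           (component_set (g * h)%g) =
      mulset (mulset (component_set (g * h)%g) (component_set h^-1%g))
             (component_set h).

Definition symmetrically_graded : Prop :=
  forall g,
    mulset (mulset (component_set g) (component_set g^-1%g)) (component_set g) =
    component_set g.

End Graded.

(* Main.v *)
From HB Require Import structures.
Require Import Defs.
From mathcomp Require Import all_boot all_order all_algebra.
From mathcomp Require Import boolp classical_sets.

(** The equivalence rests on one reformulation of the dual basis lemma.
    Suppose that [a i] in S_g and [b i] in S_(g^-1) satisfy
    [t = \sum_i (t * a i) * b i] for all t in S_(g^-1).  Read as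
    [t = t * (\sum_i a i * b i)], this says that the element
    [\sum_i a i * b i] of S_g S_(g^-1) is a right unit on S_(g^-1); read as an
    expansion of t along the [b i] with the R-linear coefficients [t * a i], it
    says that [b] and the maps [t |-> t * a i] form a dual basis of the left
    R-module S_(g^-1).  A module has a finite dual basis exactly when it is
    finitely generated and projective ([dual_basis_exists],
    [dual_basis_finitely_generated], [dual_basis_projective]), and the
    coefficients can all be written [t * a i] as soon as n_g is onto.  This
    links (iii) with (iv).  The other relation, that the same element is a left
    unit on S_g, is equivalent to the injectivity of n_g, given the first:
    [t * (eps * s) = t * s] for all t in S_(g^-1).

    Assertions (i) and (ii) concern products of additive subgroups.  An element
    acting as the unit on S_g and S_(g^-1) is the unit of the ideal
    S_g S_(g^-1), and inserting it between factors turns S_g S_h into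
    S_g S_(g^-1) S_g S_h, which lies in S_g S_(g^-1) S_(gh); the reverse
    inclusion only uses the grading.  Conversely (i) with h = e says that the
    grading is symmetric, and then the unit of S_g S_(g^-1) fixes
    S_g = S_g S_(g^-1) S_g on the left and the unit of S_(g^-1) S_g fixes it on
    the right. *)

Set Implicit Arguments.
Unset Strict Implicit.
Unset Printing Implicit Defensive.

Import GRing.Theory.
Local Open Scope ring_scope.

(** * Dual bases of modules *)

Section DualBasis.
Context {R : nzRingType} {M : lmodType R}.

Definition dual_basis n (v : 'I_n -> M) (f : 'I_n -> left_dual M) : Prop :=
  forall m : M, m = \sum_(i < n) dual_eval (f i) m *: v i.

Definition lin_comb (A : lmodType R) n (v : 'I_n -> A)
  (c : {ffun 'I_n -> R^o}) : A := \sum_(i < n) (c i : R) *: v i.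

Lemma lin_comb_linear (A : lmodType R) n (v : 'I_n -> A) :
  linear (lin_comb v).
Proof.
move=> a c d; rewrite /lin_comb scaler_sumr -big_split; apply: eq_bigr => i _.
by rewrite !ffunE scalerDl scalerA.
Qed.

HB.instance Definition _ (A : lmodType R) n (v : 'I_n -> A) :=
  GRing.isLinear.Build R {ffun 'I_n -> R^o} A *:%R (lin_comb v)
    (lin_comb_linear v).

(** Generators give a surjection from a free module; by projectivity it splits,
    and the coordinates of the splitting are the required linear forms. *)
Lemma dual_basis_exists : finitely_generated M -> projective M ->
  exists n (v : 'I_n -> M) (f : 'I_n -> left_dual M), dual_basis v f.
Proof.
move=> [n [v vgen]] projM.
have onto (m : M) : exists c, lin_comb v c = m.
  have [c ->] := vgen m; exists [ffun i => c i].
  by apply: eq_bigr => i _; rewrite ffunE.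
have [h hK] :=
  projM _ _ (lin_comb v : {linear _ -> _}) (idfun : {linear M -> M}) onto.
have coordL i : linear ((fun m => h m i) : M -> R^o).
  by move=> a x y; rewrite linearP !ffunE.
exists n, v, (fun i => mk_dual (coordL i)) => m.
by rewrite -[LHS](hK m).
Qed.

Lemma dual_basis_finitely_generated n (v : 'I_n -> M) (f : 'I_n -> left_dual M) :
  dual_basis v f -> finitely_generated M.
Proof. by move=> vf; exists n, v => m; eexists; apply: vf. Qed.

(** To lift a map, lift its values at the [v i] arbitrarily and extend linearly
    along the coordinates [f i]. *)
Lemma dual_basis_projective n (v : 'I_n -> M) (f : 'I_n -> left_dual M) :
  dual_basis v f -> projective M.
Proof.
move=> vf A B p q onto.
have [w wE] := choice (fun i => onto (q (v i))).
pose lift m := lin_comb w [ffun i => dual_eval (f i) m].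
have liftL : linear lift.
  move=> a x y; rewrite /lift -linearP; congr lin_comb.
  by apply/ffunP => i; rewrite !ffunE dual_linearP.
pose L := GRing.isLinear.Build R M A *:%R lift liftL.
exists (HB.pack_for {linear M -> A} lift L) => m /=.
rewrite {2}[m]vf /lift /lin_comb !linear_sum; apply: eq_bigr => i _.
by rewrite !linearZ wE ffunE.
Qed.

End DualBasis.

(** * Products of subsets of a ring *)

Section ProductSets.
Context {S : nzRingType}.
Implicit Types X Y Z : set S.
Local Open Scope classical_set_scope.

Lemma mulset0 X Y : mulset X Y 0.
Proof.
by exists 0, (fun=> 0), (fun=> 0); split=> [[]|[]|] //; rewrite big_ord0.
Qed.

Lemma mulsetM X Y x y : X x -> Y y -> mulset X Y (x * y).
Proof.
by move=> Xx Yy; exists 1, (fun=> x), (fun=> y); rewrite big_ord1.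
Qed.

Lemma mulsetD X Y a b :
  mulset X Y a -> mulset X Y b -> mulset X Y (a + b).
Proof.
move=> [m [x [y [Xx Yy ->]]]] [n [x' [y' [Xx' Yy' ->]]]].
exists (m + n),
  (fun i => match split i with inl j => x j | inr k => x' k end),
  (fun i => match split i with inl j => y j | inr k => y' k end).
split=> [i|i|]; [by case: split | by case: split |].
rewrite big_split_ord; congr (_ + _); apply: eq_bigr => i _.
  by rewrite (unsplitK (inl i)).
by rewrite (unsplitK (inr i)).
Qed.

(** The products [x * y] generate the additive monoid XY, so a property stable
    under sums need only be checked on them. *)
Lemma mulset_min X Y (P : S -> Prop) : P 0 ->
  (forall a b, P a -> P b -> P (a + b)) ->
  (forall x y, X x -> Y y -> P (x * y)) ->
  forall z, mulset X Y z -> P z.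
Proof.
move=> P0 PD PM z [n [x [y [Xx Yy ->]]]].
by elim/big_ind: _ => // i _; apply: PM.
Qed.

Lemma mulsetA X Y Z : mulset (mulset X Y) Z = mulset X (mulset Y Z).
Proof.
apply/seteqP; split; apply: mulset_min; try exact: mulset0; try exact: mulsetD.
  move=> a z + Zz; move: a; apply: mulset_min => [|a b|x y Xx Yy].
  - by rewrite mul0r; apply: mulset0.
  - by rewrite mulrDl; apply: mulsetD.
  - by rewrite -mulrA; apply: mulsetM => //; apply: mulsetM.
move=> x a Xx; move: a; apply: mulset_min => [|a b|y z Yy Zz].
- by rewrite mulr0; apply: mulset0.
- by rewrite mulrDr; apply: mulsetD.
- by rewrite mulrA; apply: mulsetM => //; apply: mulsetM.
Qed.

Lemma mulset_mono X X' Y Y' :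
  X `<=` X' -> Y `<=` Y' -> mulset X Y `<=` mulset X' Y'.
Proof.
move=> XX YY; apply: mulset_min; [exact: mulset0 | exact: mulsetD |].
by move=> x y /XX Xx /YY; apply: mulsetM.
Qed.

Lemma mulset_fixl X Y (u : S) : (forall x, X x -> u * x = x) ->
  forall z, mulset X Y z -> u * z = z.
Proof.
move=> uX; apply: mulset_min => [|a b|x y /uX ux _].
- by rewrite mulr0.
- by rewrite mulrDr => -> ->.
- by rewrite mulrA ux.
Qed.

Lemma mulset_fixr X Y (u : S) : (forall y, Y y -> y * u = y) ->
  forall z, mulset X Y z -> z * u = z.
Proof.
move=> uY; apply: mulset_min => [|a b|x y _ /uY yu].
- by rewrite mul0r.
- by rewrite mulrDl => -> ->.
- by rewrite -mulrA yu.
Qed.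

End ProductSets.

(** * Products of homogeneous components *)

Section GradedRing.
Context {G : groupType} {S : nzRingType} {gr : grading G S}.
Implicit Types g h : G.
Local Open Scope classical_set_scope.

Local Notation comp g := (component_set gr g).
Local Notation cmul g h := (mulset (comp g) (comp h)).

Lemma cmul_comp g h : cmul g h `<=` comp (g * h)%g.
Proof.
apply: mulset_min => [|a b|x y]; first exact: rpred0.
  exact: rpredD.
exact: component_mul.
Qed.

Lemma cmul_oner g : cmul g 1%g = comp g.
Proof.
apply/seteqP; split; first by rewrite -{2}[g]mulg1; apply: cmul_comp.
by move=> x gx; rewrite -[x]mulr1; apply: mulsetM => //; apply: component1.
Qed.

Lemma cmul_ideal g : base_ideal gr (cmul g g^-1%g).
Proof.
split; first by rewrite -(mulgV g); apply: cmul_comp.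
- exact: mulset0.
- move=> x y Ix Iy; apply: mulsetD => //; move: y Iy.
  apply: mulset_min => [|a b|s t gs gt].
  + by rewrite oppr0; apply: mulset0.
  + by rewrite opprD; apply: mulsetD.
  + by rewrite -mulNr; apply: mulsetM => //; rewrite /component_set/= rpredN.
- move=> r x re; move: x; apply: mulset_min => [|a b [? ?] [? ?]|s t gs gt].
  + by rewrite mulr0 mul0r; split; apply: mulset0.
  + by rewrite mulrDr mulrDl; split; apply: mulsetD.
  split.
    rewrite mulrA; apply: mulsetM => //.
    by have := component_mul re gs; rewrite mul1g.
  rewrite -mulrA; apply: mulsetM => //.
  by have := component_mul gt re; rewrite mulg1.
Qed.

(** * Local units *)

Definition local_units (eps : G -> S) : Prop :=
  forall g, cmul g g^-1%g (eps g) /\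
    (forall s, s \in gr g -> eps g * s = s /\ s * eps g^-1%g = s).

Lemma epsilon_strong_symmetric :
  epsilon_strongly_graded gr -> symmetrically_graded gr.
Proof.
move=> [_ eqs] g; have [+ _] := eqs g 1%g.
by rewrite mulg1 cmul_oner.
Qed.

(** By symmetry S_g = (S_g S_(g^-1)) S_g = S_g (S_(g^-1) S_g), so the units of
    the two bracketed ideals act trivially on S_g from their side. *)
Lemma symmetric_local_units : symmetrically_graded gr ->
  (forall g, unital_ideal gr (cmul g g^-1%g)) ->
  exists eps, local_units eps.
Proof.
move=> sym unital.
have /choice[eps epsP] g : exists u, cmul g g^-1%g u /\
    forall x, cmul g g^-1%g x -> u * x = x /\ x * u = x.
  by have [_ [u Iu uP]] := unital g; exists u.
exists eps => g; have [Ie _] := epsP g; split=> // s gs; split.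
  have: comp g s := gs; rewrite -sym; apply: mulset_fixl => x Ix.
  by have [_ /(_ x Ix)[]] := epsP g.
have: comp g s := gs; rewrite -sym mulsetA; apply: mulset_fixr => x.
by have [_ /(_ x)] := epsP g^-1%g; rewrite invgK => + Ix => /(_ Ix)[].
Qed.

Section FromLocalUnits.
Variables (eps : G -> S) (epsP : local_units eps).

Lemma local_unit_left g s : s \in gr g -> eps g * s = s.
Proof. by have [_ H] := epsP g; move=> /H[]. Qed.

Lemma local_unit_right g t : t \in gr g^-1%g -> t * eps g = t.
Proof. by have [_ H] := epsP g^-1%g; move=> /H[_]; rewrite invgK. Qed.

(** Inserting [eps g] in front of S_g S_h produces a factor S_g S_(g^-1),
    and inserting [eps h^-1] behind produces S_(h^-1) S_h. *)
Lemma local_units_epsilon_strong : epsilon_strongly_graded gr.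
Proof.
have E1 g h : cmul g h = mulset (cmul g g^-1%g) (comp (g * h)%g).
  apply/seteqP; split.
    move=> z zgh; rewrite -(mulset_fixl (@local_unit_left g) zgh).
    by apply: mulsetM; [have [] := epsP g | apply: cmul_comp].
  rewrite mulsetA; apply: mulset_mono => // z /cmul_comp.
  by rewrite mulKg.
have E2 g h : cmul g h = mulset (mulset (comp (g * h)%g) (comp h^-1%g)) (comp h).
  apply/seteqP; split.
    move=> z zgh; rewrite mulsetA.
    have fixr y : comp h y -> y * eps h^-1%g = y.
      by have [_ H] := epsP h; move=> /H[].
    rewrite -(mulset_fixr fixr zgh).
    apply: mulsetM; first exact: cmul_comp.
    by have [] := epsP h^-1%g; rewrite invgK.
  apply: mulset_mono => // z /cmul_comp.
  by rewrite mulgK.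
split=> [g|g h]; last by rewrite -E1 -E2.
split; first exact: cmul_ideal.
exists (eps g) => [|x Ix]; first by have [] := epsP g.
split; first by apply: (mulset_fixl _ Ix); exact: local_unit_left.
by apply: (mulset_fixr _ Ix); exact: local_unit_right.
Qed.

End FromLocalUnits.

(** * Local units and duality *)

Lemma val_sum g n (F : 'I_n -> piece gr g) :
  val (\sum_(i < n) F i) = \sum_(i < n) val (F i).
Proof. exact: raddf_sum. Qed.

Lemma cmulP g h z : cmul g h z ->
  exists n (a : 'I_n -> piece gr g) (b : 'I_n -> piece gr h),
    z = \sum_(i < n) val (a i) * val (b i).
Proof.
move=> [n [a [b [ag bh ->]]]].
by exists n, (fun i => Sub (a i) (ag i)), (fun i => Sub (b i) (bh i)).
Qed.

Lemma to_dual_linear g : linear (@to_dual _ _ gr g).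
Proof.
move=> r x y; apply: dual_evalP => t; apply: val_inj.
by rewrite /= mulrDr mulrA.
Qed.

(** Both sides are the identity [t = \sum_i (t * a i) * b i], bracketed in the
    two possible ways; this is the bridge between units and modules. *)
Lemma right_unit_dual_basis g n (a : 'I_n -> right_piece gr g)
    (b : 'I_n -> piece gr g^-1%g) :
  dual_basis b (fun i => to_dual (a i)) <->
  forall t, t \in gr g^-1%g -> t * (\sum_(i < n) val (a i) * val (b i)) = t.
Proof.
have E (t : piece gr g^-1%g) :
    val (\sum_(i < n) dual_eval (to_dual (a i)) t *: b i) =
    val t * (\sum_(i < n) val (a i) * val (b i)).
  by rewrite val_sum mulr_sumr; apply: eq_bigr => i _; rewrite /= mulrA.
split=> [ab t gt|abE t]; last by apply: val_inj; rewrite E abE ?(valP t).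
by have := E (Sub t gt); rewrite -ab SubK.
Qed.

(** Take a dual basis of S_(g^-1) and pull its functionals back along n_g; the
    resulting right unit is also a left unit because n_g is injective. *)
Lemma dual_local_units :
  (forall g, [/\ finitely_generated (piece gr g),
                 projective (piece gr g) &
                 module_iso (@to_dual _ _ gr g)]) ->
  exists eps, local_units eps.
Proof.
move=> dual.
have /choice[eps epsP] g : exists u, [/\ cmul g g^-1%g u,
    forall s, s \in gr g -> u * s = s &
    forall t, t \in gr g^-1%g -> t * u = t].
  have [_ _ [_ [inv toK invK]]] := dual g.
  have [fg proj _] := dual g^-1%g.
  have [n [b [f bf]]] := dual_basis_exists fg proj.
  pose a i := inv (f i).
  have /right_unit_dual_basis ufix :
      dual_basis b (fun i => to_dual (a i)).
    by move=> m; rewrite {1}[m]bf; apply: eq_bigr => i _; rewrite invK.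
  have uI : cmul g g^-1%g (\sum_(i < n) val (a i) * val (b i)).
    exists n, (fun i => val (a i)), (fun i => val (b i)).
    by split=> // i; [exact: (valP (a i)) | exact: (valP (b i))].
  set u := \sum_(i < n) _ in ufix uI; exists u; split=> // s gs.
  have gus : u * s \in gr g.
    have := cmul_comp uI; rewrite mulgV => ue.
    by have := component_mul ue gs; rewrite mul1g.
  (* n_g is injective, and t * (u * s) = (t * u) * s = t * s for all t *)
  suff /(can_inj toK)/(congr1 val) : to_dual (Sub (u * s) gus) =
      to_dual (Sub s gs) by [].
  apply: dual_evalP => t; apply: val_inj.
  by rewrite /= mulrA ufix // (valP t).
exists eps => g; have [Ie el _] := epsP g; split=> // s gs; split; first exact: el.
by have [_ _] := epsP g^-1%g; rewrite invgK; apply.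
Qed.

(** For the inverse of n_g, write [eps g = \sum_i a i * b i] and send a
    functional f on S_(g^-1) to [\sum_i a i * f (b i)]. *)
Lemma local_units_to_dual_iso eps : local_units eps ->
  forall g, module_iso (@to_dual _ _ gr g).
Proof.
move=> epsP g; split; first exact: to_dual_linear.
have [/cmulP[n [a [b ab]]] _] := epsP g.
have /right_unit_dual_basis bas t : t \in gr g^-1%g ->
    t * (\sum_(i < n) val (a i) * val (b i)) = t.
  by rewrite -ab; apply: local_unit_right.
pose inv (f : left_dual (piece gr g^-1%g)) : right_piece gr g :=
  \sum_(i < n) (dual_eval f (b i) : (base_ring gr)^c) *:
               (a i : right_piece gr g).
have invE f : val (inv f) = \sum_(i < n) val (a i) * val (dual_eval f (b i)).
  by rewrite val_sum.
exists inv => [s|f].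
  apply: val_inj; rewrite invE -[RHS](local_unit_left epsP (valP s)).
  by rewrite ab mulr_suml; apply: eq_bigr => i _; rewrite /= mulrA.
apply: dual_evalP => t; rewrite [in RHS](bas t).
rewrite /dual_eval linear_sum; apply: val_inj => /=.
rewrite invE val_sum mulr_sumr; apply: eq_bigr => i _.
by rewrite linearZ /= mulrA.
Qed.

Lemma local_units_finite_projective eps : local_units eps ->
  forall g, finitely_generated (piece gr g) /\
            projective (piece gr g).
Proof.
(* dual bases arise for components indexed by an inverse *)
move=> epsP g; rewrite -[g]invgK; move: g^-1%g => {}g.
have [/cmulP[n [a [b ab]]] _] := epsP g.
have /right_unit_dual_basis bas t : t \in gr g^-1%g ->
    t * (\sum_(i < n) val (a i) * val (b i)) = t.
  by rewrite -ab; apply: local_unit_right.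
split; first exact: dual_basis_finitely_generated bas.
exact: dual_basis_projective bas.
Qed.

End GradedRing.

Theorem proposition7 (G : groupType) (S : nzRingType) (gr : grading G S) :
  [<-> (* (i) *)
       epsilon_strongly_graded gr;
       (* (ii) *)
       symmetrically_graded gr /\
       (forall g : G,
          unital_ideal gr
            (mulset (component_set gr g) (component_set gr g^-1%g)));
       (* (iii) *)
       exists eps : G -> S, forall g : G,
         mulset (component_set gr g) (component_set gr g^-1%g) (eps g) /\
         (forall s : S, s \in gr g -> eps g * s = s /\ s * eps g^-1%g = s);
       (* (iv) *)
       forall g : G,
         [/\ finitely_generated (piece gr g),
             projective (piece gr g) &
             module_iso (@to_dual G S gr g)]].
Proof.
tfae.
- by move=> i; split; [exact: epsilon_strong_symmetric | case: i].
- by move=> [sym unital]; exact: symmetric_local_units.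
- move=> [eps epsP] g.
  have [fg proj] := local_units_finite_projective epsP g.
  by split=> //; exact: local_units_to_dual_iso epsP g.
- by move=> /dual_local_units[eps]; exact: local_units_epsilon_strong.
Qed.
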